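(* Let $X$ be the Markovian agent-based model on the graph $G=(V,E)$ with generator $Q$ on $\mathcal{X}^N$ (defined in the context), let $T=((t_{u,v}))_{u,v\in\mathcal{X}^N}$ be the transition probability matrix of its uniformization, and let $\pi$ be the stationary distribution of the uniformization, $\pi T=\pi$. For $k\ge 1$ let $T_k^{\pi}=((t^{\pi,k}_{u,v}))$ be the transition probability matrix of the $\pi$-lifting associated with the aggregation of $\mathcal{X}^N$ into the equivalence classes of $k$-local symmetry. Then the approximation error is monotonically non-increasing in the order of local symmetry: $$D_{\mathrm{KL}}\left(T \,\|\, T_{k+1}^{\pi}\right)\le D_{\mathrm{KL}}\left(T \,\|\, T_{k}^{\pi}\right)\quad\text{for all } k\ge 1,$$ where $$D_{\mathrm{KL}}\left(T\,\|\,T_k^{\pi}\right)=\sum_{u\in\mathcal{X}^N}\sum_{v\in\mathcal{X}^N}\pi_u t_{u,v}\log\left(\frac{t_{u,v}}{t^{\pi,k}_{u,v}}\right).$$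
   Context: **The model.** $G=(V,E)$ is a finite undirected graph without self-loops, $V=\{1,\dots,N\}$, $E\subseteq V\times V$ with $(u,v)\in E\iff(v,u)\in E$. The local state space is $\mathcal{X}=\{1,\dots,K\}$ and global states are $x=(x_1,\dots,x_N)\in\mathcal{X}^N$. For $l\ge 1$ let $\Lambda(l,K)=\{y\in\mathbb{N}_0^K: y_1+\dots+y_K=l\}$. For a tuple $z\in\mathcal{X}^l$, $c(z)=(y_1,\dots,y_K)\in\Lambda(l,K)$ with $y_a=|\{j: z_j=a\}|$, and $c(\emptyset)=\emptyset$. For $i\in V$, $n_i(x)$ is the tuple of the local states $x_j$ of all neighbours $j$ of $i$ (those $j$ with $(i,j)\in E$), and $n_i(x)=\emptyset$ if $i$ has no neighbours. A local intensity function is given: $\gamma:\mathcal{X}\times\mathcal{X}\times(\{\emptyset\}\cup\bigcup_{l=1}^{N-1}\Lambda(l,K))\to[0,\infty)$. $X$ is the continuous time Markov chain on $\mathcal{X}^N$ with generator $Q=((q_{x,y}))$, $$q_{x,y}=\sum_{i=1}^N \mathbf{1}(x_i\ne y_i,\ x_j=y_j\ \forall j\ne i)\,\gamma(x_i,y_i,c(n_i(x)))\quad (x\neq y),\qquad q_{x,x}=-\sum_{y\ne x}q_{x,y}.$$ Its uniformization is the discrete time Markov chain with transition matrix $T=I+Q/\lambda$, where $\lambda>0$ is a fixed constant with $\lambda\ge\max_x(-q_{x,x})$. **Local symmetry.** $d(u,v)$ is the graph distance ($\infty$ if no path exists), $N_k(u)=\{v\in V: d(u,v)\le k\}$, and $G[N_k(u)]$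 is the induced subgraph. Vertices $u,v$ are $k$-locally symmetric, $u\overset{k}{\sim}v$, if there is a graph isomorphism $f$ from $G[N_k(u)]$ to $G[N_k(v)]$ with $f(u)=v$. Let $\Psi_k(G)$ be the group of all permutations $f$ of $V$ such that $u\overset{k}{\sim}f(u)$ for all $u\in V$. For $f\in\Psi_k(G)$ and $x\in\mathcal{X}^N$ define $f\cdot x\in\mathcal{X}^N$ by $(f\cdot x)_i=x_{f(i)}$. States $x,y\in\mathcal{X}^N$ are $k$-locally symmetric equivalent, $x\overset{k}{\sim}y$, if $y=f\cdot x$ for some $f\in\Psi_k(G)$. Let $\mathcal{X}^{(k)}_1,\dots,\mathcal{X}^{(k)}_{M_k}$ be the equivalence classes in $\mathcal{X}^N$; set $\eta_k(x)=i$ iff $x\in\mathcal{X}^{(k)}_i$, and let $\langle x\rangle_k$ be the class containing $x$. **Aggregation and $\pi$-lifting.** For $i,j\in\{1,\dots,M_k\}$, $$\tilde t^{(k)}_{i,j}=\frac{\sum_{u\in\mathcal{X}^{(k)}_i}\pi_u\sum_{v\in\mathcal{X}^{(k)}_j}t_{u,v}}{\sum_{u\in\mathcal{X}^{(k)}_i}\pi_u},\qquad t^{\pi,k}_{u,v}=\frac{\pi_v}{\sum_{x\in\langle v\rangle_k}\pi_x}\,\tilde t^{(k)}_{\eta_k(u),\eta_k(v)}\quad(u,v\in\mathcal{X}^N).$$ In the Kullback–Leibler divergence rate, terms with $\pi_u t_{u,v}=0$ are interpreted as $0$. *)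

(* Defs.v *)
(* MathComp / MathComp-Analysis *)
From mathcomp Require Import all_boot all_order all_algebra all_fingroup.
From mathcomp Require Import reals exp.

Set Implicit Arguments.
Unset Strict Implicit.
Unset Printing Implicit Defensive.

Import Order.TTheory GRing.Theory Num.Theory.

Local Open Scope ring_scope.

Section LocalSymmetry.
Variables (V : finType) (e : rel V).

Definition walk (n : nat) (u v : V) : bool :=
  [exists p : n.-tuple V, path e u p && (last u p == v)].

Lemma connect_walk (u v : V) : connect e u v -> exists n, walk n u v.
Proof.
case/connectP=> p ep ->; exists (size p).
by apply/existsP; exists (in_tuple p); rewrite ep eqxx.
Qed.

(* [None] is the distance between vertices in different components. *)
Definition gdist (u v : V) : option nat :=
  if @idP (connect e u v) is ReflectT uv then Some (ex_minn (connect_walk uv))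
  else None.

Definition nbhd (k : nat) (u : V) : {set V} :=
  [set v | if gdist u v is Some d then (d <= k)%N else false].

(* Isomorphisms of the induced subgraphs e[A] and e[B]; the values of [f]
   outside of [A] are irrelevant. *)
Definition induced_iso (A B : {set V}) (f : {ffun V -> V}) : bool :=
  [&& dinjectiveb f (mem A), f @: A == B &
      [forall a in A, forall b in A, e (f a) (f b) == e a b]].

Definition locally_symmetric (k : nat) (u v : V) : bool :=
  [exists f : {ffun V -> V}, induced_iso (nbhd k u) (nbhd k v) f && (f u == v)].

Lemma locally_symmetric_refl k : reflexive (locally_symmetric k).
Proof.
move=> u; apply/existsP; exists [ffun v => v]; rewrite ffunE eqxx andbT.
apply/and3P; split.
- by apply/dinjectiveP => a b _ _; rewrite !ffunE.
- by apply/eqP/setP => v; rewrite (eq_imset _ (g := id)) ?imset_id // => w;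
    rewrite ffunE.
- by apply/forall_inP => a _; apply/forall_inP => b _; rewrite !ffunE.
Qed.

Lemma locally_symmetric_trans k : transitive (locally_symmetric k).
Proof.
move=> v u w /existsP[f /andP[/and3P[fI /eqP fA /forall_inP fE] /eqP fu]].
case/existsP=> g /andP[/and3P[gI /eqP gA /forall_inP gE] /eqP gv].
have fN a : a \in nbhd k u -> f a \in nbhd k v.
  by move=> ua; rewrite -fA imset_f.
apply/existsP; exists [ffun z => g (f z)]; rewrite ffunE fu gv eqxx andbT.
apply/and3P; split.
- apply/dinjectiveP => a b ua ub; rewrite !ffunE => gfab.
  move/dinjectiveP: fI; apply=> //.
  by move/dinjectiveP: gI; apply=> //; apply: fN.
- by rewrite -gA -fA -imset_comp; apply/eqP/eq_imset => z; rewrite ffunE.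
- apply/forall_inP => a ua; apply/forall_inP => b ub; rewrite !ffunE.
  have /forall_inP/(_ _ (fN _ ub)) /eqP-> := gE _ (fN _ ua).
  exact: (forall_inP (fE _ ua)).
Qed.

Definition Psi (k : nat) : {set {perm V}} :=
  [set f : {perm V} | [forall u, locally_symmetric k u (f u)]].

Lemma Psi_group_set k : group_set (Psi k).
Proof.
apply/group_setP; split=> [|f g].
  by rewrite inE; apply/forallP => u; rewrite perm1 locally_symmetric_refl.
rewrite !inE => /forallP fP /forallP gP; apply/forallP => u; rewrite permM.
exact: locally_symmetric_trans (fP u) (gP _).
Qed.

Canonical Psi_group k := Group (Psi_group_set k).

Variable S : finType.

Definition act_state (f : {perm V}) (x : {ffun V -> S}) : {ffun V -> S} :=
  [ffun i => x (f i)].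

Definition state_equiv (k : nat) (x y : {ffun V -> S}) : bool :=
  [exists f in Psi k, y == act_state f x].

Lemma state_equiv_equivalence k : equivalence_rel (state_equiv k).
Proof.
have refl x : state_equiv k x x.
  apply/exists_inP; exists 1%g; first exact: group1.
  by apply/eqP/ffunP => i; rewrite ffunE perm1.
have sym x y : state_equiv k x y -> state_equiv k y x.
  case/exists_inP=> f fP /eqP->; apply/exists_inP; exists f^-1%g.
    by rewrite groupV.
  by apply/eqP/ffunP => i; rewrite !ffunE permKV.
have trans x y z :
    state_equiv k x y -> state_equiv k y z -> state_equiv k x z.
  case/exists_inP=> f fP /eqP-> /exists_inP[g gP /eqP->].
  apply/exists_inP; exists (g * f)%g; first by rewrite groupM.
  by apply/eqP/ffunP => i; rewrite !ffunE permM.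
move=> x y z; split=> // xy; apply/idP/idP; last exact: trans.
by apply: trans; apply: sym.
Qed.

Definition state_class (k : nat) (x : {ffun V -> S}) : {set {ffun V -> S}} :=
  [set y | state_equiv k x y].

End LocalSymmetry.

Section Aggregation.
Variables (R : realType) (S : finType).
Implicit Types (p : S -> R) (t : S -> S -> R).

Definition stationary_distribution p t : Prop :=
  [/\ forall u, 0 <= p u, \sum_u p u = 1 &
      forall v, \sum_u p u * t u v = p v].

Definition aggregated p t (A B : {set S}) : R :=
  (\sum_(u in A) p u * \sum_(v in B) t u v) / (\sum_(u in A) p u).

(* [cl] maps a point to its block: blocks serve as their own indices. As
   [x / 0 = 0], entries involving a block of mass 0 are 0. *)
Definition pi_lifting p t (cl : S -> {set S}) (u v : S) : R :=
  p v / (\sum_(x in cl v) p x) * aggregated p t (cl u) (cl v).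

(* Terms with [p u * t u v = 0] vanish whatever the value of [ln]. For
   [s = pi_lifting p t cl] with [p] stationary, [t] nonnegative and [cl] the
   blocks of a partition, [s u v > 0] whenever [p u * t u v > 0], so no other
   term meets the default values of [/] and [ln]. *)
Definition KL_rate p t (s : S -> S -> R) : R :=
  \sum_u \sum_v p u * t u v * ln (t u v / s u v).

End Aggregation.

Section Model.
Variables (R : realType) (N K : nat) (e : rel 'I_N).

Definition state := {ffun 'I_N -> 'I_K}.

(* [None] is the count of the empty tuple. *)
Definition counts (z : seq 'I_K) : option {ffun 'I_K -> nat} :=
  if z is [::] then None else Some [ffun a => count_mem a z].

Definition neighbour_states (i : 'I_N) (x : state) : seq 'I_K :=
  [seq x j | j <- enum 'I_N & e i j].

(* The set {None} U Lambda(1, K) U ... U Lambda(N - 1, K) on which local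
   intensities are prescribed. *)
Definition intensity_dom : pred (option {ffun 'I_K -> nat}) :=
  fun c => if c is Some y then (1 <= \sum_a y a <= N - 1)%N else true.

Variable gamma : 'I_K -> 'I_K -> option {ffun 'I_K -> nat} -> R.

Definition local_intensity : Prop :=
  forall a b c, c \in intensity_dom -> 0 <= gamma a b c.

Definition rate (x y : state) : R :=
  \sum_(i | (x i != y i) && [forall j, (j != i) ==> (x j == y j)])
     gamma (x i) (y i) (counts (neighbour_states i x)).

Definition generator (x y : state) : R :=
  if x == y then - \sum_(z | z != x) rate x z else rate x y.

Definition uniformization (lambda : R) (x y : state) : R :=
  (x == y)%:R + generator x y / lambda.

End Model.

(* Main.v *)
(* Both sides are relative entropies of w(u, v) = p u * t u v on pairs of
   states: up to the factor p u, the pi-lifting redistributes the w-mass of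
   each block A x B of pairs in proportion to p (x) p. An isomorphism of
   neighbourhoods of order k + 1 restricts to neighbourhoods of order k, so the
   blocks of order k + 1 refine those of order k. For nested partitions, with
   q and q' the coarse and the fine redistribution, q'/q is the ratio of the
   masses that w and q give to fine blocks, so the difference of the two
   relative entropies is nonnegative by ln x >= 1 - 1 / x. *)
Require Import Defs.
From mathcomp Require Import all_boot all_order all_algebra all_fingroup.
From mathcomp Require Import reals exp.
From mathcomp Require Import ring lra.

Set Implicit Arguments.
Unset Strict Implicit.
Unset Printing Implicit Defensive.

Import Order.TTheory GRing.Theory Num.Theory.

Local Open Scope ring_scope.

(** * Monotonicity of local symmetry in its order *)

Section LocalSymmetry.
Variables (V : finType) (e : rel V).

(** Trades the minimal distance for any walk of bounded length, which allows induction on the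
    radius. *)
Lemma nbhdP k u v :
  reflect (exists2 n, (n <= k)%N & walk e n u v) (v \in nbhd e k u).
Proof.
rewrite inE /gdist; case: {-}_ / idP => [uv|nuv].
  case: ex_minnP => d dw dmin; apply: (iffP idP) => [dk|[n nk nw]]; first by exists d.
  exact: leq_trans (dmin _ nw) nk.
apply: (iffP idP) => // -[n _ /existsP[p /andP[ep /eqP lp]]].
by case: nuv; apply/connectP; exists p.
Qed.

Lemma walk0 u v : walk e 0 u v = (v == u).
Proof.
apply/existsP/eqP => [[p]|->]; first by rewrite tuple0 /= => /eqP.
by exists [tuple] => /=.
Qed.

Lemma walkS n u v : reflect (exists2 w, walk e n u w & e w v) (walk e n.+1 u v).
Proof.
apply: (iffP existsP) => [[p /andP[ep /eqP <-]]|[w /existsP[p /andP[ep /eqP pw]] wv]].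
  case: p ep => p /= /eqP; case/lastP: p => // p x; rewrite size_rcons => -[sp].
  rewrite rcons_path last_rcons => /andP[ep px]; exists (last u p) => //.
  by apply/existsP; exists (Tuple (introT eqP sp)); rewrite /= ep eqxx.
by exists [tuple of rcons p v]; rewrite /= rcons_path last_rcons ep pw wv eqxx.
Qed.

Lemma nbhd0 u : nbhd e 0 u = [set u].
Proof.
apply/setP => v; rewrite inE -walk0.
by apply/nbhdP/idP => [[n]|]; [rewrite leqn0 => /eqP-> | exists 0%N].
Qed.

Lemma nbhdS n u v :
  reflect (v \in nbhd e n u \/ exists2 w, w \in nbhd e n u & e w v)
          (v \in nbhd e n.+1 u).
Proof.
apply: (iffP (nbhdP _ _ _)) => [[m]|[/nbhdP[m mn uv]|[w /nbhdP[m mn uw] wv]]].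
- rewrite leq_eqVlt ltnS => /orP[/eqP-> /walkS[w uw wv]|mn uv].
    by right; exists w => //; apply/nbhdP; exists n.
  by left; apply/nbhdP; exists m.
- by exists m => //; apply: leqW.
- by exists m.+1 => //; apply/walkS; exists w.
Qed.

Lemma nbhd_sub m n u : (m <= n)%N -> nbhd e m u \subset nbhd e n u.
Proof.
move=> mn; apply/subsetP => v /nbhdP[d dm uv].
by apply/nbhdP; exists d => //; apply: leq_trans mn.
Qed.

(* Edges with both ends in the k-neighbourhood are preserved and reflected by f,
   which gives the two inclusions by induction on n. *)
Lemma induced_iso_nbhd k u (f : {ffun V -> V}) n : (n <= k)%N ->
  induced_iso e (nbhd e k u) (nbhd e k (f u)) f ->
  f @: nbhd e n u = nbhd e n (f u).
Proof.
move=> + /and3P[_ /eqP fim /forall_inP fE].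
have eF a b : a \in nbhd e k u -> b \in nbhd e k u -> e (f a) (f b) = e a b.
  by move=> ua ub; have /forall_inP/(_ _ ub)/eqP := fE _ ua.
elim: n => [_|n IHn nk]; first by rewrite !nbhd0 imset_set1.
have sub w z : z \in nbhd e n w -> z \in nbhd e k w.
  by apply/subsetP/nbhd_sub/ltnW.
have subS w z : z \in nbhd e n.+1 w -> z \in nbhd e k w.
  by apply/subsetP/nbhd_sub.
apply/setP => y; apply/imsetP/idP => [[x xu ->]|yu].
  apply/nbhdS; rewrite -(IHn (ltnW nk)).
  have [xn|[w wn wx]] := nbhdS _ _ _ xu; [left|right]; first exact: imset_f.
  by exists (f w); rewrite ?imset_f // eF ?(subS _ _ xu) ?(sub _ _ wn).
(* With [y = f x] and [x] in the [k]-neighbourhood, an edge from [f w] to [y] reflects to an edge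
   from [w] to [x]. *)
have /imsetP[x xu yE] : y \in f @: nbhd e k u by rewrite fim subS.
have [] := nbhdS _ _ _ yu; rewrite -(IHn (ltnW nk)).
  by case/imsetP=> z zn yz; exists z => //; apply/nbhdS; left.
case=> _ /imsetP[w wn ->]; rewrite yE eF ?(sub _ _ wn) // => wx.
by exists x => //; apply/nbhdS; right; exists w.
Qed.

(** The same [f] serves: injectivity and edge preservation restrict to subsets, and
    [induced_iso_nbhd] gives the image of the smaller neighbourhood. *)
Lemma locally_symmetric_le m k u v : (m <= k)%N ->
  locally_symmetric e k u v -> locally_symmetric e m u v.
Proof.
move=> mk /existsP[f /andP[fiso /eqP fu]]; rewrite -{}fu in fiso *.
apply/existsP; exists f; rewrite eqxx andbT.
have sub := subsetP (nbhd_sub u mk).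
apply/and3P; split.
- have /and3P[/dinjectiveP fI _ _] := fiso.
  by apply/dinjectiveP => a b /sub ua /sub ub; apply: fI.
- by rewrite (induced_iso_nbhd mk fiso).
- have /and3P[_ _ /forall_inP fE] := fiso.
  by apply/forall_inP => a /sub /fE/forall_inP aE; apply/forall_inP => b /sub /aE.
Qed.

Lemma Psi_sub m k : (m <= k)%N -> Psi e k \subset Psi e m.
Proof.
move=> mk; apply/subsetP => f; rewrite !inE => /forallP fk.
by apply/forallP => u; apply: locally_symmetric_le mk (fk u).
Qed.

Lemma state_class_sub (S : finType) m k (x : {ffun V -> S}) :
  (m <= k)%N -> state_class e k x \subset state_class e m x.
Proof.
move=> mk; apply/subsetP => y; rewrite !inE => /exists_inP[f fk yE].
by apply/exists_inP; exists f => //; apply: (subsetP (Psi_sub mk)).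
Qed.

End LocalSymmetry.

(** This is [ln (1 + y) <= y] at [y = x^-1 - 1]. *)
Lemma ln_ge_1BV (R : realType) (x : R) : 0 < x -> 1 - x^-1 <= ln x.
Proof.
move=> x0; have V0 : 0 < x^-1 by rewrite invr_gt0.
have := @le_ln1Dx R (x^-1 - 1); rewrite [1 + _]addrC subrK lnV ?posrE // => H.
have {}H : - ln x <= x^-1 - 1 by apply: H; lra.
lra.
Qed.

(** * Redistribution of mass along nested partitions *)

Section Blocks.
Variables (R : realType) (I : finType).
Implicit Types (a w : I -> R) (cl : I -> {set I}).

(** These are exactly the class maps of equivalence relations, the form of partition that
    [pi_lifting] takes. *)
Definition block_map cl : Prop :=
  (forall u, u \in cl u) /\ (forall u v, v \in cl u -> cl v = cl u).

Definition mass a cl (u : I) : R := \sum_(v in cl u) a v.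

(* The redistribution of the w-mass of each block in proportion to a; it is 0
   on blocks of a-mass 0, as x / 0 = 0. *)
Definition reproportion a w cl (u : I) : R := a u * (mass w cl u / mass a cl u).

Lemma block_mapC cl u v : block_map cl -> (u \in cl v) = (v \in cl u).
Proof. by case=> cl1 clE; apply/idP/idP => /clE ->. Qed.

Lemma mass_ge0 a cl u : (forall v, 0 <= a v) -> 0 <= mass a cl u.
Proof. by move=> a0; apply: sumr_ge0. Qed.

Lemma mass_gt0 a cl u : block_map cl -> (forall v, 0 <= a v) -> 0 < a u ->
  0 < mass a cl u.
Proof.
case=> cl1 _ a0 au; rewrite /mass (bigD1 u) //=.
by rewrite ltr_wpDr ?sumr_ge0.
Qed.

(** After exchanging sums, [w v] has weight [mass a cl v / mass a cl v]: this is 1, or 0 on a block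
    of [a]-mass 0, whose [w]-mass is lost. *)
Lemma sum_reproportion_le a w cl : block_map cl ->
  (forall v, 0 <= a v) -> (forall v, 0 <= w v) ->
  \sum_u reproportion a w cl u <= \sum_u w u.
Proof.
move=> clP a0 w0.
have -> : \sum_u reproportion a w cl u =
    \sum_v w v * (mass a cl v / mass a cl v).
  under eq_bigr => u _ do rewrite /reproportion mulrCA mulr_suml.
  rewrite (exchange_big_dep xpredT) //=; apply: eq_bigr => v _.
  rewrite -mulr_sumr; congr (_ * _); rewrite [in RHS]/mass mulr_suml.
  rewrite (eq_bigl (fun u => u \in cl v)) => [|u]; last exact: block_mapC.
  by apply: eq_bigr => u uv; rewrite /mass (clP.2 _ _ uv).
apply: ler_sum => v _; have [->|m0] := eqVneq (mass a cl v) 0.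
  by rewrite mul0r mulr0.
by rewrite divff // mulr1.
Qed.

(** A fine block lies in one coarse block, on which the factor multiplying [a] is constant. *)
Lemma mass_reproportion a w cl cl' u : block_map cl ->
  (forall v, cl' v \subset cl v) ->
  mass (reproportion a w cl) cl' u = mass a cl' u * (mass w cl u / mass a cl u).
Proof.
move=> clP sub; rewrite [in RHS]/mass mulr_suml; apply: eq_bigr => v uv.
by rewrite /reproportion /mass (clP.2 _ _ (subsetP (sub u) v uv)).
Qed.

Lemma KL_reproportion_le a w cl cl' : block_map cl -> block_map cl' ->
  (forall u, cl' u \subset cl u) ->
  (forall u, 0 <= a u) -> (forall u, 0 <= w u) ->
  (forall u, 0 < w u -> 0 < a u) ->
  \sum_u w u * ln (w u / reproportion a w cl' u) <=
  \sum_u w u * ln (w u / reproportion a w cl u).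
Proof.
move=> clP clP' sub a0 w0 wa; set q := reproportion a w cl.
have q0 u : 0 <= q u by rewrite mulr_ge0 // divr_ge0 ?mass_ge0.
have qw := sum_reproportion_le clP a0 w0.
(* Spreading [q] over the fine blocks in proportion to [w] gives the subtracted term of [step]; its
   total is at most that of [q], hence at most that of [w]. *)
have wq := sum_reproportion_le clP' w0 q0.
have step u : w u - reproportion w q cl' u <=
    w u * ln (w u / q u) - w u * ln (w u / reproportion a w cl' u).
  have := w0 u; rewrite le_eqVlt => /predU1P[w0u|wu].
    by rewrite /reproportion -w0u !mul0r subrr.
  have au := wa _ wu.
  have [ma ma'] := (mass_gt0 clP a0 au, mass_gt0 clP' a0 au).
  have [mw mw'] := (mass_gt0 clP w0 wu, mass_gt0 clP' w0 wu).
  have r0 : 0 < mass w cl u / mass a cl u by rewrite divr_gt0.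
  have r0' : 0 < mass w cl' u / mass a cl' u by rewrite divr_gt0.
  rewrite /reproportion (mass_reproportion _ _ _ clP sub) /q /reproportion.
  rewrite -mulrBr -[X in X - _]mulr1 -mulrBr ler_wpM2l //.
  have wr : 0 < w u / (a u * (mass w cl u / mass a cl u)).
    by rewrite divr_gt0 ?(mulr_gt0 au r0).
  have wr' : 0 < w u / (a u * (mass w cl' u / mass a cl' u)).
    by rewrite divr_gt0 ?(mulr_gt0 au r0').
  rewrite -ln_div ?posrE //.
  (* Here [x] is the fine redistribution divided by [q]; [w u] and [a u] cancel, so [x^-1] is the
     ratio of the masses that [q] and [w] give to the fine block. *)
  set x := (X in _ <= ln X).
  suff <- : x^-1 = mass a cl' u * (mass w cl u / mass a cl u) / mass w cl' u.
    by apply: ln_ge_1BV; apply: divr_gt0.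
  by rewrite /x; field; rewrite !lt0r_neq0.
rewrite -subr_ge0 -sumrB; apply: le_trans (ler_sum _ (fun u _ => step u)).
by rewrite sumrB subr_ge0 (le_trans wq qw).
Qed.

End Blocks.

(** * The lifting as a redistribution on pairs of states *)

Section Lifting.
Variables (R : realType) (S : finType).
Implicit Types (p : S -> R) (t : S -> S -> R) (cl : S -> {set S}).

Definition block_prod cl (z : S * S) : {set S * S} := setX (cl z.1) (cl z.2).

Lemma block_map_prod cl : block_map cl -> block_map (block_prod cl).
Proof.
case=> cl1 clE; split=> [u|u v]; first by rewrite inE !cl1.
by rewrite inE => /andP[/clE v1 /clE v2]; rewrite /block_prod v1 v2.
Qed.

(** The [p]-mass of a product block factors, and its [w]-mass is the numerator of [aggregated].
    Blocks of mass 0 are covered, as [0^-1 = 0] keeps inversion multiplicative. *)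
Lemma reproportion_prod p t cl u v :
  reproportion (fun z => p z.1 * p z.2) (fun z => p z.1 * t z.1 z.2)
    (block_prod cl) (u, v) = p u * pi_lifting p t cl u v.
Proof.
rewrite /reproportion /pi_lifting /aggregated /mass /=.
have -> : \sum_(z in block_prod cl (u, v)) p z.1 * p z.2 =
    (\sum_(x in cl u) p x) * (\sum_(y in cl v) p y).
  by rewrite big_distrlr pair_big /=; apply: eq_bigl => z; rewrite inE.
have -> : \sum_(z in block_prod cl (u, v)) p z.1 * t z.1 z.2 =
    \sum_(x in cl u) p x * \sum_(y in cl v) t x y.
  under [RHS]eq_bigr => x _ do rewrite mulr_sumr.
  by rewrite pair_big /=; apply: eq_bigl => z; rewrite inE.
by rewrite invfM -mulrA; congr (_ * _); rewrite -[RHS]mulrA; congr (_ * _); ring.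
Qed.

(** The factor [p u] cancels inside the logarithm unless it is 0, and then both terms vanish. *)
Lemma KL_rate_reproportion p t cl : KL_rate p t (pi_lifting p t cl) =
  let w z := p z.1 * t z.1 z.2 in
  \sum_z w z *
    ln (w z / reproportion (fun z => p z.1 * p z.2) w (block_prod cl) z).
Proof.
rewrite /KL_rate pair_bigA; apply: eq_bigr => -[u v] _ /=.
have [->|pu] := eqVneq (p u) 0; first by rewrite !mul0r.
by rewrite reproportion_prod -mulf_div divff // mul1r.
Qed.

Lemma KL_rate_refine p t cl cl' : stationary_distribution p t ->
  (forall u v, 0 <= t u v) -> block_map cl -> block_map cl' ->
  (forall u, cl' u \subset cl u) ->
  KL_rate p t (pi_lifting p t cl') <= KL_rate p t (pi_lifting p t cl).
Proof.
case=> p0 _ pt t0 clP clP' sub; rewrite !KL_rate_reproportion /=.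
apply: KL_reproportion_le => [||[u v]|[u v]|[u v]|[u v]] /=.
- exact: block_map_prod.
- exact: block_map_prod.
- exact: setXS.
- exact: mulr_ge0.
- exact: mulr_ge0.
- move=> w0; have pu : 0 < p u.
    by rewrite lt0r p0 andbT; apply: contraTneq w0 => ->; rewrite mul0r ltxx.
  (* By stationarity [p v >= p u * t u v > 0]. *)
  rewrite mulr_gt0 // -pt (bigD1 u) //= ltr_wpDr // sumr_ge0 // => x _.
  exact: mulr_ge0.
Qed.

End Lifting.

(** * Nonnegativity of the uniformization *)

Lemma sum_count_mem (T : finType) (z : seq T) : (\sum_a count_mem a z)%N = size z.
Proof.
elim: z => [|x z IHz] /=; first by rewrite big1.
rewrite big_split /= IHz (bigD1 x) //= eqxx big1 // => a.
by rewrite eq_sym => /negPf->.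
Qed.

Section Model.
Variables (R : realType) (N K : nat) (e : rel 'I_N).
Variable gamma : 'I_K -> 'I_K -> option {ffun 'I_K -> nat} -> R.

Lemma counts_neighbour_states i (x : state N K) : irreflexive e ->
  counts (neighbour_states e i x) \in @intensity_dom N K.
Proof.
move=> e_irr; have : (size (neighbour_states e i x) <= N - 1)%N.
  rewrite size_map size_filter -[X in (_ <= X - 1)%N]size_enum_ord.
  rewrite -[X in (_ <= X - 1)%N](count_predC (e i)).
  (* The vertex [i] is not its own neighbour, which accounts for the 1 in [N - 1]. *)
  rewrite -addnBA ?leq_addr // -has_count; apply/hasP.
  by exists i; rewrite ?mem_enum //= e_irr.
rewrite /counts unfold_in; case: neighbour_states => [|a z] // zN.
rewrite (eq_bigr (fun b => count_mem b (a :: z))) ?sum_count_mem // => b _.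
by rewrite ffunE.
Qed.

Lemma rate_ge0 x y : irreflexive e -> local_intensity N gamma ->
  0 <= rate e gamma x y.
Proof.
move=> e_irr gamma_ge0; apply: sumr_ge0 => i _.
exact/gamma_ge0/counts_neighbour_states.
Qed.

Lemma uniformization_ge0 lambda x y :
  irreflexive e -> local_intensity N gamma -> 0 < lambda ->
  - generator e gamma x x <= lambda -> 0 <= uniformization e gamma lambda x y.
Proof.
move=> e_irr gamma_ge0 l0 lx; rewrite /uniformization; have [<-|xy] := eqVneq x y.
  by rewrite addrC -lerBlDr sub0r ler_pdivlMr // mulN1r lerNl.
by rewrite add0r /generator (negPf xy) divr_ge0 ?rate_ge0 // ltW.
Qed.

End Model.

Lemma block_map_state_class (V S : finType) (e : rel V) k :
  block_map (@state_class V e S k).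
Proof.
have eqv := @state_equiv_equivalence V e S k; split=> [x|x y].
  by rewrite inE; case: (eqv x x x).
rewrite inE => xy; apply/setP => z; rewrite !inE.
by have [_ /(_ xy)] := eqv x y z.
Qed.

Theorem theorem2 (R : realType) (N K : nat) (e : rel 'I_N)
  (e_sym : symmetric e) (e_irr : irreflexive e)
  (gamma : 'I_K -> 'I_K -> option {ffun 'I_K -> nat} -> R)
  (gamma_ge0 : local_intensity N gamma)
  (lambda : R) (lambda_gt0 : 0 < lambda)
  (lambda_ge : forall x : state N K, - generator e gamma x x <= lambda)
  (p : state N K -> R)
  (p_stat : stationary_distribution p (uniformization e gamma lambda))
  (k : nat) (k_ge1 : (1 <= k)%N) :
  let T := uniformization e gamma lambda in
  let lifted (m : nat) := pi_lifting p T (state_class e m) in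
  KL_rate p T (lifted k.+1) <= KL_rate p T (lifted k).
Proof.
cbv zeta; apply: KL_rate_refine => //.
- by move=> x y; apply: uniformization_ge0.
- exact: block_map_state_class.
- exact: block_map_state_class.
- by move=> x; apply: state_class_sub.
Qed.
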